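(* Let $A_r\subseteq A$ be a relatively separable inclusion of unital associative algebras over a field $\mathbb{F}$ with chosen element $e=e^{(1)}\otimes e^{(2)}\in A_r\otimes A$, let $C$ be an associative algebra, and let $\pi:A\to C$ be a relatively multiplicative map (relative to $A_r$, $e$). For a left $C$-module $M$ define the vector space $$\pi^*(M)=A_r\otimes M\,/\,\mathrm{span}\{x\otimes m-e^{(1)}\otimes\pi(e^{(2)}x)m \mid x\in A_r,\ m\in M\},$$ and write $x\boxtimes m$ for the image of $x\otimes m$ in $\pi^*(M)$. Then: (a) $\pi^*(M)$ has a left $A$-module structure with action given by $a\cdot(x\boxtimes m)=e^{(1)}\boxtimes\pi(e^{(2)}ax)m$ for $a\in A$, $x\in A_r$, $m\in M$; (b) for every $C$-linear map $f:M\to N$ between left $C$-modules $M,N$, there is a unique $A$-linear map $\pi^*(f):\pi^*(M)\to\pi^*(N)$ such that $\pi^*(f)\circ q_M=q_N\circ(\mathrm{id}_{A_r}\otimes f)$, where $q_M:A_r\otimes M\to\pi^*(M)$ and $q_N:A_r\otimes N\to\pi^*(N)$ are the quotient maps; (c) $\pi^*$ is functorial.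
   Context: All algebras are over a fixed field $\mathbb{F}$; $C$ is not assumed unital. Tensors are written in Sweedler-like notation: $e=e^{(1)}\otimes e^{(2)}$ denotes a finite sum of simple tensors. An inclusion $A_r\subseteq A$ of unital associative algebras is relatively separable if there is $e=e^{(1)}\otimes e^{(2)}\in A_r\otimes A$ such that $xe^{(1)}\otimes e^{(2)}=e^{(1)}\otimes e^{(2)}x$ for all $x\in A_r$ and $e^{(1)}e^{(2)}=1_A$. A relatively multiplicative map from $A$ to $C$ (relative to $A_r\subseteq A$ with element $e$) is a linear map $\pi:A\to C$ such that $\pi(ab)=\pi(ae^{(1)})\,\pi(e^{(2)}b)$ for all $a,b\in A$. *)

(* Defs.v *)
From HB Require Import structures.
From mathcomp Require Import all_boot all_algebra generic_quotient ring_quotient.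
From mathcomp Require Import freeg boolp.

Set Implicit Arguments.
Unset Strict Implicit.
Unset Printing Implicit Defensive.

Import GRing.Theory.
Local Open Scope ring_scope.
Local Open Scope quotient_scope.

Section QuotientBySpan.
Variables (F : fieldType) (V : lmodType F) (S : V -> Prop).

Definition span : {pred V} := fun v =>
  `[< exists s : seq (F * V),
        (forall p, p \in s -> S p.2) /\ v = \sum_(p <- s) p.1 *: p.2 >].

Fact span_zmod_closed : zmod_closed span.
Proof.
split=> [|_ _ /asboolP[s [sS ->]] /asboolP[t [tS ->]]].
  by apply/asboolP; exists [::]; rewrite big_nil.
apply/asboolP; exists (s ++ [seq (- p.1, p.2) | p <- t]); split=> [p|].
  by rewrite mem_cat => /orP[/sS//|/mapP[q /tS qS ->]].
rewrite big_cat big_map /= -sumrN; congr (_ + _).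
by apply: eq_bigr => p _; rewrite scaleNr.
Qed.

HB.instance Definition _ := GRing.isZmodClosed.Build V span span_zmod_closed.

Lemma spanZ c v : v \in span -> c *: v \in span.
Proof.
move=> /asboolP[s [sS ->]]; apply/asboolP.
exists [seq (c * p.1, p.2) | p <- s]; split=> [p /mapP[q /sS qS ->]//|].
by rewrite big_map scaler_sumr; apply: eq_bigr => p _; rewrite scalerA.
Qed.

Lemma mem_span v : S v -> v \in span.
Proof.
move=> Sv; apply/asboolP; exists [:: (1, v)].
by split=> [p|]; rewrite ?big_seq1 ?scale1r // inE => /eqP->.
Qed.

Definition quot_span : Type := Quotient.quot span.

HB.instance Definition _ : EqQuotient V (Quotient.equiv span) quot_span :=
  EqQuotient.on quot_span.
HB.instance Definition _ := GRing.Zmodule.on quot_span.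
HB.instance Definition _ := ZmodQuotient.on quot_span.

Definition qclass (v : V) : quot_span := \pi_quot_span v.

Lemma qclass_eq v w : (qclass v = qclass w) <-> (v - w \in span).
Proof. by rewrite (Quotient.idealrBE span); split=> /eqP. Qed.

Lemma qclassK (z : quot_span) : qclass (repr z) = z.
Proof. exact: reprK. Qed.

Fact qclass_is_zmod_morphism : zmod_morphism qclass.
Proof. exact: (raddfB \pi_quot_span). Qed.

HB.instance Definition _ :=
  GRing.isZmodMorphism.Build V quot_span qclass qclass_is_zmod_morphism.

Definition qscale (c : F) (z : quot_span) : quot_span := qclass (c *: repr z).

Fact qscaleE c v : qscale c (qclass v) = qclass (c *: v).
Proof.
apply/qclass_eq; rewrite -scalerBr spanZ //.
by apply/qclass_eq; rewrite qclassK.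
Qed.

Fact qscaleA a b z : qscale a (qscale b z) = qscale (a * b) z.
Proof. by rewrite -[z]qclassK !qscaleE scalerA. Qed.
Fact qscale1 : left_id 1 qscale.
Proof. by move=> z; rewrite -[z]qclassK qscaleE scale1r. Qed.
Fact qscaleDr : right_distributive qscale +%R.
Proof.
move=> c y z; rewrite -[y]qclassK -[z]qclassK -raddfD !qscaleE.
by rewrite scalerDr raddfD.
Qed.
Fact qscaleDl z : {morph qscale^~ z : a b / a + b}.
Proof. by move=> a b; rewrite -[z]qclassK !qscaleE scalerDl raddfD. Qed.

HB.instance Definition _ := GRing.Zmodule_isLmodule.Build F quot_span
  qscaleA qscale1 qscaleDr qscaleDl.

Fact qclass_is_scalable : scalable qclass.
Proof. by move=> c v; rewrite -qscaleE. Qed.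

HB.instance Definition _ :=
  GRing.isScalable.Build F V quot_span *:%R qclass qclass_is_scalable.

End QuotientBySpan.

Section Tensor.
Variables (F : fieldType) (U V : lmodType F).

Local Notation gen u v := (<< (u, v) >> : {freeg (U * V)%type / F}).

Variant tensor_rel : {freeg (U * V)%type / F} -> Prop :=
| TensorDl u u' v : tensor_rel (gen (u + u') v - gen u v - gen u' v)
| TensorDr u v v' : tensor_rel (gen u (v + v') - gen u v - gen u v')
| TensorZl c u v : tensor_rel (gen (c *: u) v - c *: gen u v)
| TensorZr c u v : tensor_rel (gen u (c *: v) - c *: gen u v).

Definition tensor : lmodType F := quot_span tensor_rel.

Definition tens (u : U) (v : V) : tensor := qclass tensor_rel (gen u v).

(* Sweedler notation: if t is the sum of the c_i *: tens u_i v_i, for the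
   finite decomposition of t picked by repr, then tsum f t is the sum of the
   c_i *: f u_i v_i. When f is bilinear the result does not depend on the
   decomposition (tsum_linear, tsum_tens). *)
Definition tsum (W : lmodType F) (f : U -> V -> W) (t : tensor) : W :=
  let D : {freeg (U * V)%type / F} := repr (t : quot_span tensor_rel) in
  \sum_(p <- dom D) coeff p D *: f p.1 p.2.

End Tensor.

Notation "\tsum_ ( u # v <- t ) E" := (tsum (fun u v => E) t)
  (at level 36, E at level 36, u name, v name, t at level 50,
   format "\tsum_ ( u  #  v  <-  t )  E") : ring_scope.

Definition bilinear_map (F : fieldType) (U V W : lmodType F)
    (f : U -> V -> W) : Prop :=
  (forall v, linear (f^~ v)) /\ (forall u, linear (f u)).

Section TensorTheory.
Variables (F : fieldType) (U V : lmodType F).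

Lemma tens_bilinear : bilinear_map (@tens F U V).
Proof.
have qrel x : tensor_rel x -> qclass (@tensor_rel F U V) x = 0.
  move=> rx; rewrite -[RHS](raddf0 (qclass (@tensor_rel F U V))).
  by apply/qclass_eq; rewrite subr0 mem_span.
split=> [v c u u'|u c v v']; rewrite /tens.
  have /qrel := TensorDl (c *: u) u' v; have /qrel := TensorZl c u v.
  rewrite !raddfB /= => /eqP; rewrite subr_eq0 => /eqP->.
  by move=> /eqP; rewrite -addrA -opprD subr_eq0 linearZ => /eqP.
have /qrel := TensorDr u (c *: v) v'; have /qrel := TensorZr c u v.
rewrite !raddfB /= => /eqP; rewrite subr_eq0 => /eqP->.
by move=> /eqP; rewrite -addrA -opprD subr_eq0 linearZ => /eqP.
Qed.

Lemma tsum_tens_self (t : tensor U V) : \tsum_(u # v <- t) tens u v = t.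
Proof.
rewrite -[RHS]qclassK -[in RHS](freeg_sumE (repr _)) raddf_sum.
apply: eq_bigr => p _; rewrite /tens -linearZ; congr qclass.
apply/eqP/freeg_eqP => z; rewrite coeffZ !coeffU -surjective_pairing.
by rewrite mul1r.
Qed.

Variables (W : lmodType F) (f : U -> V -> W).
Hypothesis f_bil : bilinear_map f.

Definition tlift : {freeg (U * V)%type / F} -> W :=
  fglift (fun p => f p.1 p.2).
Local Notation lift := tlift.

Fact tlift_zmod : zmod_morphism lift.
Proof. exact: lift_is_additive. Qed.

HB.instance Definition _ := GRing.isZmodMorphism.Build _ _ lift tlift_zmod.

Let liftE (D : {freeg (U * V)%type / F}) :
  lift D = \sum_(p <- dom D) coeff p D *: f p.1 p.2.
Proof.
rewrite -[D in LHS]freeg_sumE raddf_sum.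
by apply: eq_bigr => p _ /=; rewrite /tlift liftU.
Qed.

Let lift1 u v : lift << (u, v) >> = f u v.
Proof. by rewrite /tlift liftU scale1r. Qed.

Fact tlift_scalable : scalable lift.
Proof.
move=> c D; rewrite -[D in LHS]freeg_sumE scaler_sumr raddf_sum liftE scaler_sumr.
apply: eq_bigr => p _ /=.
have -> : c *: << coeff p D *g p >> = << c * coeff p D *g p >> :> {freeg _ / F}.
  by apply/eqP/freeg_eqP => z; rewrite coeffZ !coeffU mulrA.
by rewrite /tlift liftU scalerA.
Qed.

HB.instance Definition _ := GRing.isScalable.Build F _ _ *:%R lift tlift_scalable.

Let lift_span : {in span (@tensor_rel F U V), forall D, lift D = 0}.
Proof.
case: f_bil => fl fr _ /asboolP[s [sS ->]].
rewrite raddf_sum big_seq big1 // => p /sS /= rel_p; rewrite tlift_scalable.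
suff -> : tlift p.2 = 0 by rewrite scaler0.
case: rel_p => [u u' v|u v v'|c u v|c u v]; rewrite !raddfB /= !lift1.
- by have := fl v 1 u u'; rewrite !scale1r => ->; rewrite -addrA -opprD subrr.
- by have := fr u 1 v v'; rewrite !scale1r => ->; rewrite -addrA -opprD subrr.
- have f0 : f 0 v = 0.
    by have := fl v (-1) 0 0; rewrite scaler0 addr0 scaleN1r addNr.
  have := fl v c u 0; rewrite /= f0 !addr0 tlift_scalable lift1 => ->.
  by rewrite subrr.
- have f0 : f u 0 = 0.
    by have := fr u (-1) 0 0; rewrite scaler0 addr0 scaleN1r addNr.
  have := fr u c v 0; rewrite f0 !addr0 tlift_scalable lift1 => ->.
  by rewrite subrr.
Qed.

Let tsum_qclass D : tsum f (qclass (@tensor_rel F U V) D) = lift D.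
Proof.
rewrite /tsum -liftE; apply/eqP; rewrite -subr_eq0 -raddfB /=.
by apply/eqP/lift_span/qclass_eq/qclassK.
Qed.

Lemma tsum_tens u v : tsum f (tens u v) = f u v.
Proof. by rewrite tsum_qclass lift1. Qed.

Lemma tsum_linear : linear (tsum f : tensor U V -> W).
Proof.
move=> c t t'; rewrite -[t]qclassK -[t']qclassK -linearZ -raddfD /=.
by rewrite !tsum_qclass linearP.
Qed.

End TensorTheory.

HB.mixin Record Lmodule_isAssocAlg (F : fieldType) B of GRing.Lmodule F B := {
  amul : B -> B -> B;
  amul_bilinear : bilinear_map amul;
  amulA : associative amul
}.

#[short(type="assocAlgType")]
HB.structure Definition AssocAlg (F : fieldType) :=
  {B of GRing.Lmodule F B & Lmodule_isAssocAlg F B}.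

Notation "a ** b" := (amul a b) (at level 40, left associativity) : ring_scope.

(* Used instead of algType, which imposes 1 != 0 and excludes the zero
   algebra. *)

HB.mixin Record AssocAlg_hasUnit (F : fieldType) B of AssocAlg F B := {
  aone : B;
  amul1l : left_id aone amul;
  amul1r : right_id aone amul
}.

#[short(type="unitalAlgType")]
HB.structure Definition UnitalAlg (F : fieldType) :=
  {B of AssocAlg F B & AssocAlg_hasUnit F B}.

(* A unital subalgebra B of A is given as an injective morphism. *)
Record unital_inclusion (F : fieldType) (B A : unitalAlgType F)
    (iota : {linear B -> A}) : Prop := UnitalInclusion {
  inclusion_inj : injective iota;
  inclusionM : {morph iota : x y / x ** y};
  inclusion1 : iota aone = aone
}.

Section Modules.
Variables (F : fieldType) (B : assocAlgType F).

Record left_action (V : lmodType F) (act : B -> V -> V) : Prop := LeftAction {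
  left_action_bilinear : bilinear_map act;
  left_actionM : forall a b v, act (a ** b) v = act a (act b v)
}.

Record lmodule := LModule {
  lmodule_sort :> lmodType F;
  lact : B -> lmodule_sort -> lmodule_sort;
  lactP : left_action lact
}.

Record lhom (M N : lmodule) := LHom {
  lhom_fun :> {linear M -> N};
  lhom_act : forall b m, lhom_fun (lact b m) = lact b (lhom_fun m)
}.

Lemma lhom_eq (M N : lmodule) (f g : lhom M N) : f =1 g -> f = g.
Proof.
case: f g => [[f fc] fP] [[g gc] gP] /= /funext fg; case: _ / fg in gc gP *.
case: fc gc fP gP => [[f1] [f2]] [[g1] [g2]] fP gP.
rewrite (Prop_irrelevance g1 f1) (Prop_irrelevance g2 f2) in gP *.
by rewrite (Prop_irrelevance gP fP).
Qed.

Definition lhom_id (M : lmodule) : lhom M M :=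
  @LHom M M idfun (fun b m => erefl).

Fact lhom_comp_act (M N P : lmodule) (g : lhom N P) (f : lhom M N) b m :
  (g \o f) (lact b m) = lact b ((g \o f) m).
Proof. by rewrite /= !lhom_act. Qed.

Definition lhom_comp (M N P : lmodule) (g : lhom N P) (f : lhom M N) :
  lhom M P := @LHom M P (g \o f) (lhom_comp_act g f).

End Modules.

Definition unital_module (F : fieldType) (A : unitalAlgType F)
    (M : lmodule A) : Prop :=
  forall m : M, lact aone m = m.

Definition tens_map (F : fieldType) (U U' V V' : lmodType F)
    (g : U -> U') (f : V -> V') (t : tensor U V) : tensor U' V' :=
  \tsum_(u # v <- t) tens (g u) (f v).

Section RelativelyMultiplicative.
Variables (F : fieldType) (Ar A : unitalAlgType F) (iota : {linear Ar -> A}).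
Variable e : tensor Ar A.

Definition separability_element : Prop :=
  (forall x : Ar, \tsum_(e1 # e2 <- e) tens (x ** e1) e2
                  = \tsum_(e1 # e2 <- e) tens e1 (e2 ** iota x)) /\
  \tsum_(e1 # e2 <- e) (iota e1 ** e2) = aone.

Variables (C : assocAlgType F) (pi : {linear A -> C}).

Definition relatively_multiplicative : Prop := forall a b : A,
  pi (a ** b) = \tsum_(e1 # e2 <- e) (pi (a ** iota e1) ** pi (e2 ** b)).

Variable M : lmodule C.

Variant pistar_rel : tensor Ar M -> Prop :=
| PistarRel (x : Ar) (m : M) : pistar_rel
    (tens x m - \tsum_(e1 # e2 <- e) tens e1 (lact (pi (e2 ** iota x)) m)).

Definition pistar : lmodType F := quot_span pistar_rel.

Definition pistar_quot : {linear tensor Ar M -> pistar} := qclass pistar_rel.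

Definition boxtens (x : Ar) (m : M) : pistar := pistar_quot (tens x m).

End RelativelyMultiplicative.

(* Main.v *)
Require Import Defs.
From HB Require Import structures.
From mathcomp Require Import all_boot all_algebra.
From mathcomp Require Import generic_quotient.

Set Implicit Arguments.
Unset Strict Implicit.
Unset Printing Implicit Defensive.

Import GRing.Theory.
Local Open Scope ring_scope.

(** Write x [*] m for the class of x (x) m. The idea is to let the first factor
    range over all of A: put
      y [*] m := e1 [*] pi (e2 y) m   for y in A ([boxA]).
    The relations defining pi^*(M) say exactly that this extends the box symbol
    along the inclusion of Ar into A ([boxA_iota]), so the proposed action reads
    a . (x [*] m) = (a x) [*] m. Relative multiplicativity of pi, after
    exchanging two sums over e, becomes
      (a b) [*] m = (a e1) [*] pi (e2 b) m   ([boxAM]).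
    For b = x in Ar this is the well-definedness of the action on the quotient;
    for b in A it says that a . (b [*] m) = (a b) [*] m ([act_boxA]), from which
    associativity and unitality of the action are those of A.

    A C-linear f satisfies f (pi (e2 x) m) = pi (e2 x) (f m), so id (x) f
    respects the relations; the induced map sends y [*] m to y [*] f m for all
    y in A, hence is A-linear. Linear maps out of pi^*(M) are determined by
    their values on the classes x [*] m ([pistar_ext]), which gives uniqueness
    and functoriality. *)

(** * Linear maps and Sweedler sums *)

Section LinearFacts.
Variables (F : fieldType) (U V W W' : lmodType F).

Lemma linear_comp (g : W -> W') (f : V -> W) :
  linear g -> linear f -> linear (g \o f).
Proof. by move=> gl fl c v v' /=; rewrite fl gl. Qed.

Lemma linear_fun0 (h : W -> W') : linear h -> h 0 = 0.
Proof.
by move=> hl; have := hl (-1) 0 0; rewrite scaler0 addr0 scaleN1r addNr.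
Qed.

Lemma eq_tsum (f g : U -> V -> W) (t : tensor U V) :
  f =2 g -> tsum f t = tsum g t.
Proof. by move=> fg; apply: eq_bigr => p _; rewrite fg. Qed.

(** Both sides are linear combinations over the same fixed decomposition of t. *)
Lemma linear_tsum (h : W -> W') (f : U -> V -> W) (t : tensor U V) :
  linear h -> h (tsum f t) = \tsum_(u # v <- t) h (f u v).
Proof.
move=> hl; have h0 := linear_fun0 hl; rewrite /tsum.
apply: (big_rec2 (fun x y => h x = y)) => // p x y _ <-.
exact: hl.
Qed.

Lemma tsum_linear_fun (f : W' -> U -> V -> W) (t : tensor U V) :
  (forall u v, linear (fun w => f w u v)) -> linear (fun w => tsum (f w) t).
Proof.
move=> fl c w w'; rewrite /tsum scaler_sumr -big_split /=.
by apply: eq_bigr => p _; rewrite fl scalerDr !scalerA mulrC.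
Qed.

End LinearFacts.

(** The simple tensors span: t is the Sweedler sum of its own components. *)
Lemma tensor_ext (F : fieldType) (U V W : lmodType F)
    (g h : tensor U V -> W) :
  linear g -> linear h -> (forall u v, g (tens u v) = h (tens u v)) -> g =1 h.
Proof.
move=> gl hl gh t; rewrite -(tsum_tens_self t) (linear_tsum _ _ gl).
by rewrite (linear_tsum _ _ hl); apply: eq_tsum.
Qed.

Lemma tsumC (F : fieldType) (U V U' V' W : lmodType F)
    (f : U -> V -> U' -> V' -> W) (t : tensor U V) (t' : tensor U' V') :
  \tsum_(u # v <- t) (\tsum_(u' # v' <- t') f u v u' v')
  = \tsum_(u' # v' <- t') (\tsum_(u # v <- t) f u v u' v').
Proof.
rewrite /tsum; under eq_bigr do rewrite scaler_sumr.
rewrite exchange_big; apply: eq_bigr => p _; rewrite scaler_sumr.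
by apply: eq_bigr => q _; rewrite !scalerA mulrC.
Qed.

(** * Linear maps out of a quotient by a span *)

Section QuotLift.
Variables (F : fieldType) (V W : lmodType F) (S : V -> Prop) (h : V -> W).
Hypotheses (h_lin : linear h) (h_rel : forall v, S v -> h v = 0).

Definition quot_lift (z : quot_span S) : W := h (repr z).

(** The chosen representative of the class of v differs from v by a linear
    combination of elements of S, which h kills. *)
Lemma quot_lift_qclass v : quot_lift (qclass S v) = h v.
Proof.
have [hD hZ h0] : [/\ {morph h : x y / x + y}, scalable h & h 0 = 0].
  have h0 := linear_fun0 h_lin.
  split=> // [x y|c x]; first by rewrite -[x in LHS]scale1r h_lin scale1r.
  by rewrite -[_ *: x in LHS]addr0 h_lin h0 addr0.
have /qclass_eq/boolp.asboolP[s [sS Ev]] := qclassK (qclass S v).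
rewrite /quot_lift -[repr _](subrK v) hD Ev (big_morph h hD h0) big_seq.
by rewrite big1 ?add0r // => p /sS/h_rel hp; rewrite hZ hp scaler0.
Qed.

Lemma quot_lift_linear : linear quot_lift.
Proof.
move=> c y z; rewrite -[y]qclassK -[z]qclassK -linearP.
by rewrite !quot_lift_qclass h_lin.
Qed.

End QuotLift.

(** * Linearity of products and actions *)

Section AlgebraFacts.
Variables (F : fieldType) (B : assocAlgType F).

Lemma amul_linearl (b : B) : linear (fun a : B => a ** b).
Proof. exact: amul_bilinear.1. Qed.

Lemma amul_linearr (a : B) : linear (fun b : B => a ** b).
Proof. exact: amul_bilinear.2. Qed.

Lemma lact_linearl (M : lmodule B) (m : M) : linear (fun b => lact b m).
Proof. exact: (left_action_bilinear (lactP M)).1. Qed.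

Lemma lact_linearr (M : lmodule B) (b : B) :
  linear (lact b : M -> M).
Proof. exact: (left_action_bilinear (lactP M)).2. Qed.

End AlgebraFacts.

(** * The space pi^*(M) and its action of A *)

Section PiStar.
Variables (F : fieldType) (Ar A : unitalAlgType F) (iota : {linear Ar -> A}).
Variables (e : tensor Ar A) (C : assocAlgType F) (pi : {linear A -> C}).

Section Object.
Variable M : lmodule C.
Local Notation P := (pistar iota e pi M).
Local Notation box := (boxtens iota e pi).

Lemma boxtens_linearl m : linear (fun x => box x m : P).
Proof. by move=> c x y; rewrite /boxtens (tens_bilinear Ar M).1 linearP. Qed.

Lemma boxtens_linearr x : linear (fun m => box x m : P).
Proof. by move=> c m n; rewrite /boxtens (tens_bilinear Ar M).2 linearP. Qed.

Lemma pistar_ext (W : lmodType F) (g h : P -> W) :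
  linear g -> linear h -> (forall x m, g (box x m) = h (box x m)) -> g =1 h.
Proof.
move=> gl hl gh z; rewrite -[z]qclassK.
have ql : linear (pistar_quot iota e pi M) by exact: linearP.
apply: (tensor_ext (linear_comp gl ql) (linear_comp hl ql)) => x m.
exact: gh.
Qed.

(** Universal property of pi^*(M): a bilinear map factors through it as soon as
    it is compatible with the relations x (x) m ~ e1 (x) pi (e2 x) m. *)
Lemma pistar_lift (W : lmodType F) (f : Ar -> M -> W) :
  bilinear_map f ->
  (forall x m,
     f x m = \tsum_(e1 # e2 <- e) f e1 (lact (pi (e2 ** iota x)) m)) ->
  exists g : P -> W, linear g /\ forall x m, g (box x m) = f x m.
Proof.
move=> fbil fbal; have fl := tsum_linear fbil.
have f_rel v : pistar_rel iota e pi v -> tsum f v = 0.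
  case=> x m; rewrite -scaleN1r addrC fl scaleN1r (linear_tsum _ _ fl).
  rewrite (tsum_tens fbil); under eq_tsum do rewrite (tsum_tens fbil).
  by rewrite -fbal addNr.
exists (quot_lift (tsum f)); split; first exact: quot_lift_linear.
move=> x m; rewrite /boxtens /pistar_quot quot_lift_qclass //.
exact: tsum_tens.
Qed.

(** The extension of the box symbol to first arguments in A; it turns the
    formula for the action into left multiplication. *)
Definition boxA (y : A) (m : M) : P :=
  \tsum_(e1 # e2 <- e) box e1 (lact (pi (e2 ** y)) m).

Lemma boxA_linearl m : linear (boxA^~ m).
Proof.
apply: tsum_linear_fun => x a c y z.
by rewrite amul_linearr linearP lact_linearl boxtens_linearr.
Qed.

Lemma boxA_linearr y : linear (boxA y).
Proof.
apply: tsum_linear_fun => x a c m n.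
by rewrite lact_linearr boxtens_linearr.
Qed.

(** This is the defining relation of pi^*(M). *)
Lemma boxA_iota x m : boxA (iota x) m = box x m.
Proof.
rewrite /boxA /boxtens.
have ql : linear (pistar_quot iota e pi M) by exact: linearP.
rewrite -(linear_tsum _ _ ql); apply/esym/qclass_eq/mem_span.
exact: PistarRel.
Qed.

Hypothesis pi_mul : relatively_multiplicative iota e pi.

(** Expanding pi (f2 a b) by relative multiplicativity inside the sum over a
    second copy f of e gives a double sum; summing over f first yields the
    right-hand side. *)
Lemma boxAM a b m :
  boxA (a ** b) m
  = \tsum_(e1 # e2 <- e) boxA (a ** iota e1) (lact (pi (e2 ** b)) m).
Proof.
rewrite tsumC; apply: eq_tsum => f1 f2.
have cl : linear (fun c : C => box f1 (lact c m) : P).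
  exact: linear_comp (boxtens_linearr _) (lact_linearl _).
rewrite amulA pi_mul (linear_tsum _ _ cl); apply: eq_tsum => e1 e2.
by rewrite (left_actionM (lactP M)) amulA.
Qed.

(** With b = iota x, [boxAM] is the compatibility with the relations that is
    needed to lift (x, m) |-> (a x) [*] m. *)
Lemma pistar_act_exists :
  exists act : A -> P -> P, (forall a, linear (act a)) /\
    forall a x m, act a (box x m) = boxA (a ** iota x) m.
Proof.
suff actP a : exists g : P -> P,
    linear g /\ forall x m, g (box x m) = boxA (a ** iota x) m.
  by have [act /all_and2[]] := boolp.choice actP; exists act.
apply: pistar_lift => [|x m]; last exact: boxAM.
split=> [m|x]; last exact: boxA_linearr.
by move=> c x y; rewrite linearP amul_linearr boxA_linearl.
Qed.

Variable act : A -> P -> P.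
Hypothesis act_linear : forall a, linear (act a).
Hypothesis act_box : forall a x m, act a (box x m) = boxA (a ** iota x) m.

(** The value on a y in A is a sum of values on classes from Ar, and [boxAM]
    folds that sum back. *)
Lemma act_boxA a b m : act a (boxA b m) = boxA (a ** b) m.
Proof.
rewrite boxAM (linear_tsum _ _ (act_linear a)).
by apply: eq_tsum => e1 e2; rewrite act_box.
Qed.

Lemma pistar_left_action : left_action act.
Proof.
split=> [|a b z].
  split=> // z c a b.
  apply: (pistar_ext (g := act (c *: a + b))
                     (h := fun z => c *: act a z + act b z)).
  - exact: act_linear.
  - by move=> k y t; rewrite !act_linear !scalerDr !scalerA mulrC addrACA.
  - by move=> x m; rewrite !act_box amul_linearl boxA_linearl.
move: z; apply: (pistar_ext (g := act (a ** b)) (h := act a \o act b)).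
- exact: act_linear.
- exact: linear_comp.
- by move=> x m; rewrite /= !act_box act_boxA amulA.
Qed.

(** As 1 x = x, this is again the defining relation of pi^*(M). *)
Lemma pistar_act1 z : act aone z = z.
Proof.
apply: (pistar_ext (h := id)) => // x m.
by rewrite act_box amul1l boxA_iota.
Qed.

End Object.

(** * Maps induced by C-linear maps *)

Section Morphism.
Variables (M N : lmodule C) (f : lhom M N).

Lemma pistar_map_exists :
  exists g : pistar iota e pi M -> pistar iota e pi N,
    linear g /\
    forall x m, g (boxtens iota e pi x m) = boxtens iota e pi x (f m).
Proof.
apply: pistar_lift => [|x m].
  split=> [m|x c m n]; first exact: boxtens_linearl.
  by rewrite linearP boxtens_linearr.
rewrite -boxA_iota; apply: eq_tsum => e1 e2.
by rewrite lhom_act.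
Qed.

(** A-linearity of the induced map in disguise, since a . (x [*] m) is
    (a x) [*] m with a x in A; it holds because f commutes with the action of
    each pi (e2 y). *)
Lemma pistar_map_boxA (g : pistar iota e pi M -> pistar iota e pi N) :
  linear g ->
  (forall x m, g (boxtens iota e pi x m) = boxtens iota e pi x (f m)) ->
  forall y m, g (boxA y m) = boxA y (f m).
Proof.
move=> gl gE y m; rewrite (linear_tsum _ _ gl); apply: eq_tsum => e1 e2.
by rewrite gE lhom_act.
Qed.

Lemma tens_id_bilinear :
  bilinear_map (fun (u : Ar) (v : M) => tens (idfun u) (f v)).
Proof.
split=> [v|u c v v']; first exact: (tens_bilinear Ar N).1.
by rewrite linearP (tens_bilinear Ar N).2.
Qed.

(** Both sides of the square are linear, so it may be tested on simple
    tensors. *)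
Lemma tens_map_square (g : pistar iota e pi M -> pistar iota e pi N) :
  linear g ->
  (g \o pistar_quot iota e pi M
     =1 pistar_quot iota e pi N \o tens_map idfun f)
  <-> (forall x m, g (boxtens iota e pi x m) = boxtens iota e pi x (f m)).
Proof.
have bil := tens_id_bilinear; move=> gl; split=> [gq x m|gE].
  by have := gq (tens x m); rewrite /= /tens_map (tsum_tens bil).
apply: tensor_ext => [||x m].
- by apply: (linear_comp gl); exact: linearP.
- apply: linear_comp; [exact: linearP | exact: (tsum_linear bil)].
- by rewrite /= /tens_map (tsum_tens bil); exact: gE.
Qed.

End Morphism.
End PiStar.

Theorem theorem2p3 (F : fieldType) (Ar A : unitalAlgType F)
    (iota : {linear Ar -> A}) (iota_incl : unital_inclusion iota)
    (e : tensor Ar A) (e_sep : separability_element iota e)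
    (C : assocAlgType F) (pi : {linear A -> C})
    (pi_mul : relatively_multiplicative iota e pi) :
  exists (act : forall M : lmodule C,
            A -> pistar iota e pi M -> pistar iota e pi M)
         (actP : forall M : lmodule C, left_action (act M)),
    let P (M : lmodule C) : lmodule A := LModule (actP M) in
    let q (M : lmodule C) := pistar_quot iota e pi M in
    (* (a) *)
    (forall M : lmodule C, unital_module (P M) /\
       forall (a : A) (x : Ar) (m : M),
         act M a (boxtens iota e pi x m)
         = \tsum_(e1 # e2 <- e)
             boxtens iota e pi e1 (lact (pi (e2 ** a ** iota x)) m)) /\
    (* (b) *)
    (forall (M N : lmodule C) (f : lhom M N),
       exists! g : lhom (P M) (P N), g \o q M =1 q N \o tens_map idfun f) /\
    (* (c) *)
    (exists pi_map : forall M N : lmodule C, lhom M N -> lhom (P M) (P N),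
       (forall (M N : lmodule C) (f : lhom M N),
          pi_map M N f \o q M =1 q N \o tens_map idfun f) /\
       (forall M : lmodule C, pi_map M M (lhom_id M) = lhom_id (P M)) /\
       (forall (L M N : lmodule C) (g : lhom M N) (f : lhom L M),
          pi_map L N (lhom_comp g f)
          = lhom_comp (pi_map M N g) (pi_map L M f))).
Proof.
pose act M := sval (boolp.cid (pistar_act_exists M pi_mul)).
have act_lin M a : linear (act M a).
  exact: (svalP (boolp.cid (pistar_act_exists M pi_mul))).1.
have act_box M a x m :
    act M a (boxtens iota e pi x m) = boxA iota e pi (a ** iota x) m.
  exact: (svalP (boolp.cid (pistar_act_exists M pi_mul))).2.
have actP M : left_action (act M).
  exact: pistar_left_action pi_mul _ (act_lin M) (act_box M).
exists act, actP => P q.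
have linP (M N : lmodule C) (g : lhom (P M) (P N)) : linear g by exact: linearP.
have lhom_uniq (M N : lmodule C) (f : lhom M N) (g h : lhom (P M) (P N)) :
    (forall x m, g (boxtens iota e pi x m) = boxtens iota e pi x (f m)) ->
    (forall x m, h (boxtens iota e pi x m) = boxtens iota e pi x (f m)) ->
    g = h.
  move=> gE hE; apply: lhom_eq; apply: pistar_ext (linP _ _ g) (linP _ _ h) _.
  by move=> x m; rewrite gE hE.
have lhom_ex (M N : lmodule C) (f : lhom M N) : exists g : lhom (P M) (P N),
    forall x m, g (boxtens iota e pi x m) = boxtens iota e pi x (f m).
  have [g [gl gE]] := pistar_map_exists iota e pi f.
  pose gL : {linear P M -> P N} :=
    HB.pack g (GRing.isLinear.Build _ _ _ _ g gl).
  suff gA a z : gL (act M a z) = act N a (gL z).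
    by exists (@LHom _ _ (P M) (P N) gL gA).
  apply: (pistar_ext (g := g \o act M a) (h := act N a \o g)).
  - exact: linear_comp gl (act_lin M a).
  - exact: linear_comp (act_lin N a) gl.
  - by move=> x m; rewrite /= gE !act_box (pistar_map_boxA gl gE).
pose pi_map M N f := sval (boolp.cid (lhom_ex M N f)).
have pi_mapE M N f : forall x m,
    pi_map M N f (boxtens iota e pi x m) = boxtens iota e pi x (f m).
  exact: svalP (boolp.cid (lhom_ex M N f)).
have pi_map_square M N f : pi_map M N f \o q M =1 q N \o tens_map idfun f.
  exact: (tens_map_square f (linP _ _ (pi_map M N f))).2 (pi_mapE M N f).
split=> [M|].
  split=> [z|a x m]; first exact: pistar_act1 (act_lin M) (act_box M) z.
  by rewrite act_box; apply: eq_tsum => e1 e2; rewrite amulA.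
split=> [M N f|].
  exists (pi_map M N f); split=> // g /(tens_map_square f (linP _ _ g)) gE.
  by apply: (lhom_uniq M N f); [exact: pi_mapE | exact: gE].
exists pi_map; split=> //; split=> [M|L M N g f].
  by apply: (lhom_uniq M M (lhom_id M)); [exact: pi_mapE |].
apply: (lhom_uniq L N (lhom_comp g f)); first exact: pi_mapE.
by move=> x m; rewrite /= !pi_mapE.
Qed.
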